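(* Let $(A,\oplus,\odot)$ be a $\lambda$-homomorphic brace with $(A,\oplus)=\mathbb{Z}^2$. Then there exist matrices $\varphi,\psi\in\mathrm{GL}_2(\mathbb{Z})$ such that for all $a_1,a_2,b_1,b_2\in\mathbb{Z}$ $$\begin{pmatrix}a_1\\ a_2\end{pmatrix}\oplus\begin{pmatrix}b_1\\ b_2\end{pmatrix}=\begin{pmatrix}a_1+b_1\\ a_2+b_2\end{pmatrix},\qquad \begin{pmatrix}a_1\\ a_2\end{pmatrix}\odot\begin{pmatrix}b_1\\ b_2\end{pmatrix}=\begin{pmatrix}a_1\\ a_2\end{pmatrix}+\varphi^{a_1}\psi^{a_2}\begin{pmatrix}b_1\\ b_2\end{pmatrix},$$ and the pair $(\varphi,\psi)$ satisfies at least one of the following conditions. 1. $\det\varphi=1$, $\det\psi=1$, and one of: (1.1) $\varphi\in\{E,-E\}$ and $\psi\in\{E,-E\}$; (1.2) there are $p,q,m\in\mathbb{Z}$ with $\gcd(p,q)=1$ such that $\varphi=\begin{pmatrix}1+mp^2q & mpq^2\\ -mp^3 & 1-mp^2q\end{pmatrix}$ and $\psi=\begin{pmatrix}1+mpq^2 & mq^3\\ -mp^2q & 1-mpq^2\end{pmatrix}$; (1.3) $\varphi=E$, $\psi\equiv_3\begin{pmatrix}1&*\\0&1\end{pmatrix}$ and $\mathrm{tr}(\psi)=-1$; (1.4) $\varphi\equiv_3\begin{pmatrix}1&0\\ *&1\end{pmatrix}$, $\mathrm{tr}(\varphi)=-1$ and $\psi=E$; (1.5) $\mathrm{tr}(\varphi)=-1$,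 $\psi=\varphi$, and [$\varphi\equiv_3\begin{pmatrix}0&2\\1&2\end{pmatrix}$ or $\varphi\equiv_3\begin{pmatrix}2&1\\2&0\end{pmatrix}$ or $\varphi\equiv_3E$]; (1.6) $\mathrm{tr}(\varphi)=-1$, $\psi=\varphi^{-1}$, and [$\varphi\equiv_3\begin{pmatrix}0&1\\2&2\end{pmatrix}$ or $\varphi\equiv_3\begin{pmatrix}2&2\\1&0\end{pmatrix}$ or $\varphi\equiv_3E$]. 2. $\det\varphi=1$, $\det\psi=-1$, and one of: (2.1) $\varphi=E$, $\psi\equiv_2\begin{pmatrix}1&*\\0&1\end{pmatrix}$ and $\mathrm{tr}(\psi)=0$; (2.2) $\varphi=-E$, $\psi\equiv_2E$ and $\mathrm{tr}(\psi)=0$. 3. $\det\varphi=-1$, $\det\psi=1$, and one of: (3.1) $\varphi\equiv_2\begin{pmatrix}1&0\\ *&1\end{pmatrix}$, $\mathrm{tr}(\varphi)=0$ and $\psi=E$; (3.2) $\varphi\equiv_2E$, $\mathrm{tr}(\varphi)=0$ and $\psi=-E$. 4. $\det\varphi=-1$, $\det\psi=-1$, and one of: (4.1) $\mathrm{tr}(\varphi)=0$, $\psi=\varphi$, and [$\varphi\equiv_2E$ or $\varphi\equiv_2\begin{pmatrix}0&1\\1&0\end{pmatrix}$]; (4.2) $\varphi\equiv_2E$, $\mathrm{tr}(\varphi)=0$ and $\psi=-\varphi$.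
   Context: A skew brace is a set $A$ with two binary operations $\oplus,\odot$ such that $(A,\oplus)$ and $(A,\odot)$ are groups and $a\odot(b\oplus c)=(a\odot b)\oplus(\ominus a)\oplus(a\odot c)$ for all $a,b,c\in A$, where $\ominus a$ is the inverse of $a$ in $(A,\oplus)$. It is a brace if $(A,\oplus)$ is abelian. For $a\in A$ let $\lambda_a:A\to A$, $\lambda_a(x)=\ominus a\oplus(a\odot x)$; each $\lambda_a$ is an automorphism of $(A,\oplus)$, and $a\mapsto\lambda_a$ is a homomorphism $(A,\odot)\to\mathrm{Aut}(A,\oplus)$. The skew brace is $\lambda$-homomorphic if $a\mapsto\lambda_a$ is also a homomorphism $(A,\oplus)\to\mathrm{Aut}(A,\oplus)$, i.e. $\lambda_{a\oplus b}=\lambda_a\lambda_b$ for all $a,b\in A$. Elements of $\mathbb{Z}^2$ are written as column vectors, on which matrices act by left multiplication. $E$ is the $2\times2$ identity matrix. For $2\times 2$ integer matrices and a positive integer $k$, $M\equiv_kN$ means $M=N+kC$ for some integer matrix $C$. The symbol $*$ denotes an arbitrary integer entry. *)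

(* Defs.v *)
From HB Require Import structures.
From mathcomp Require Import all_boot all_order all_algebra.
Set Implicit Arguments. Unset Strict Implicit. Unset Printing Implicit Defensive.
Import GRing.Theory.
Local Open Scope ring_scope.

Record is_group (T : Type) (op : T -> T -> T) (e : T) (inv : T -> T) : Prop :=
  IsGroup {
    is_group_assoc : associative op;
    is_group_idl : left_id e op;
    is_group_idr : right_id e op;
    is_group_invl : left_inverse e inv op;
    is_group_invr : right_inverse e inv op
  }.

Record skew_brace (A : Type) := SkewBrace {
  sb_add : A -> A -> A;
  sb_zero : A;
  sb_opp : A -> A;
  sb_mul : A -> A -> A;
  sb_one : A;
  sb_inv : A -> A;
  sb_add_group : is_group sb_add sb_zero sb_opp;
  sb_mul_group : is_group sb_mul sb_one sb_inv;
  sb_distr : forall a b c : A,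
    sb_mul a (sb_add b c) = sb_add (sb_add (sb_mul a b) (sb_opp a)) (sb_mul a c)
}.

Definition is_brace (A : Type) (B : skew_brace A) : Prop :=
  commutative (sb_add B).

Definition sb_lambda (A : Type) (B : skew_brace A) (a x : A) : A :=
  sb_add B (sb_opp B a) (sb_mul B a x).

(* Each [sb_lambda B a] is an automorphism of the additive group in any skew
   brace, so only multiplicativity of [a |-> sb_lambda B a] is required. *)
Definition lambda_homomorphic (A : Type) (B : skew_brace A) : Prop :=
  forall a b : A,
    sb_lambda B (sb_add B a b) =1 sb_lambda B a \o sb_lambda B b.

Definition vec2 (x y : int) : 'cV[int]_2 :=
  \col_(i < 2) (if i == 0 then x else y).

Definition mat2 (a b c d : int) : 'M[int]_2 :=
  \matrix_(i < 2, j < 2)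
    (if i == 0 then (if j == 0 then a else b) else (if j == 0 then c else d)).

Definition mx_congr (k : nat) (M N : 'M[int]_2) : Prop :=
  exists C : 'M[int]_2, M = N + k%:Z *: C.

(* Main.v *)
Require Import Defs.
From HB Require Import structures.
From mathcomp Require Import all_boot all_order all_algebra.
From mathcomp Require Import zify ring.
Set Implicit Arguments. Unset Strict Implicit. Unset Printing Implicit Defensive.
Import Order.TTheory GRing.Theory Num.Theory.
Local Open Scope ring_scope.

(** Write [L a] for the matrix of [sb_lambda B a]. In any skew brace [L] turns
    the multiplication of the brace into the product of matrices, here it also
    turns the addition into that product, and [a] times [b] is [a + L a b];
    comparing both rules gives [L (L a b) = L b]. Hence the image of [g - 1]
    lies in the kernel of [L] for every [g] in the group [G] of all [L a]. With
    [phi] and [psi] the values of [L] at the two basis vectors, the columns of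
    [phi - 1] and [psi - 1] are therefore exponents [(x, y)] for which [phi ^ x
    psi ^ y = 1].

    The image of [g - 1] contains [det (g - 1) Z^2], since a matrix times its
    adjugate is its determinant. So every [h] in [G] satisfies [h ^ n = 1] with
    [n = det (g - 1) = 1 - tr g + det g] ([lambda_exponent]). Taking [h = g]
    leaves four types of elements ([mat2_types]), as large traces make the
    traces of the powers grow: unipotent, order three, [-1], and reflections.
    Taking [h] different from [g] restricts the pair [(phi, psi)]: an element of
    order three forces [h ^ 3 = 1], [-1] forces [h ^ 4 = 1], and a reflection
    forces unipotent matrices to have square [1]. As a nontrivial unipotent
    matrix has infinite order, it can only be paired with unipotent matrices.

    If both are unipotent then [(phi - 1) (psi - 1) = 0], and the relations
    between exponents become linear. They say that the entries of [phi - 1] and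
    [psi - 1] form the four homogeneous coordinates of an integral point of the
    twisted cubic, which gives [p], [q] and [m] ([twisted_cubic]). In all other
    cases [G] is finite, and either both matrices are [1] or [-1] or the kernel
    of [L] is given by divisibility conditions on the exponents, which together
    with the trace are the stated congruences. *)

(** * Integer powers of a unit *)

(** Powers with integer exponents are determined by the recurrence in one
    direction, because the base can be cancelled in the other. *)
Lemma exprz_unique (R : unitRingType) (u : R) (f : int -> R) :
  u \is a GRing.unit -> f 0 = 1 -> (forall n, f (n + 1) = f n * u) ->
  forall n, u ^ n = f n.
Proof.
move=> uU f0 fS; elim/int_rect => [|n IHn|n IHn]; first by rewrite expr0z f0.
- by rewrite -addn1 PoszD exprzDr // expr1z IHn fS.
- apply: (mulIr uU); rewrite -{2}(expr1z u) -exprzDr // -fS.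
  by have -> : - n.+1%:Z + 1 = - n%:Z by lia.
Qed.

Lemma exprz_gcd_eq1 (R : unitRingType) (u : R) (m n : int) :
  u \is a GRing.unit -> u ^ m = 1 -> u ^ n = 1 -> u ^ gcdz m n = 1.
Proof.
move=> uU um un; have [x [y <-]] := Bezoutz m n.
by rewrite exprzDr // mulrC (mulrC y) -!exprz_exp um un !exp1rz mulr1.
Qed.

(** A nontrivial element killed by a prime [p] has order exactly [p]. *)
Lemma exprz_prime_dvd (R : unitRingType) (u : R) (p : nat) (n : int) :
  prime p -> u \is a GRing.unit -> u != 1 -> u ^ p%:Z = 1 -> u ^ n = 1 ->
  (p%:Z %| n)%Z.
Proof.
move=> pP uU /eqP u1 up un; case: (boolP (p%:Z %| n)%Z) => // ndvd.
case: u1; rewrite -[u]expr1z -(exprz_gcd_eq1 uU up un) /gcdz; congr (_ ^ _).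
by move: ndvd; rewrite dvdzE /= -prime_coprime // => /eqP ->.
Qed.

(** * Two by two integer matrices in coordinates *)

Lemma mat2E (A : 'M[int]_2) : A = mat2 (A 0 0) (A 0 1) (A 1 0) (A 1 1).
Proof.
apply/matrixP => -[[|[|//]] ?] [[|[|//]] ?]; rewrite mxE /=;
  by congr (A _ _); exact: val_inj.
Qed.

Lemma mat2_ind (P : 'M[int]_2 -> Prop) :
  (forall a b c d, P (mat2 a b c d)) -> forall A, P A.
Proof. by move=> h A; rewrite (mat2E A); apply: h. Qed.

Lemma mat2_inj a b c d a' b' c' d' :
  mat2 a b c d = mat2 a' b' c' d' -> [/\ a = a', b = b', c = c' & d = d'].
Proof.
by move/matrixP=> h; move: (h 0 0) (h 0 1) (h 1 0) (h 1 1); rewrite !mxE.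
Qed.

Lemma mat2M a b c d a' b' c' d' :
  mat2 a b c d * mat2 a' b' c' d' =
  mat2 (a * a' + b * c') (a * b' + b * d') (c * a' + d * c') (c * b' + d * d').
Proof.
by rewrite -mulmxE [LHS]mat2E !mxE !big_ord_recl !big_ord0 !mxE /= !addr0.
Qed.

Lemma mat2D a b c d a' b' c' d' :
  mat2 a b c d + mat2 a' b' c' d' = mat2 (a + a') (b + b') (c + c') (d + d').
Proof. by rewrite [LHS]mat2E !mxE. Qed.

Lemma mat2N a b c d : - mat2 a b c d = mat2 (- a) (- b) (- c) (- d).
Proof. by rewrite [LHS]mat2E !mxE. Qed.

Lemma mat2Z k a b c d :
  k *: mat2 a b c d = mat2 (k * a) (k * b) (k * c) (k * d).
Proof. by rewrite [LHS]mat2E !mxE. Qed.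

Lemma mat2_1 : 1 = mat2 1 0 0 1.
Proof. by rewrite [LHS]mat2E !mxE. Qed.

Lemma det_mat2 a b c d : \det (mat2 a b c d) = a * d - b * c.
Proof. 
rewrite (expand_det_row _ 0) !big_ord_recl big_ord0 /cofactor !det_mx11 !mxE /=.
by ring.
Qed.

Lemma tr_mat2 a b c d : \tr (mat2 a b c d) = a + d.
Proof. by rewrite /mxtrace !big_ord_recl big_ord0 !mxE /= addr0. Qed.

Lemma mat2_vec2 a b c d x y :
  mat2 a b c d *m vec2 x y = vec2 (a * x + b * y) (c * x + d * y).
Proof.
apply/matrixP => -[[|[|//]] ?] j;
  by rewrite !mxE !big_ord_recl big_ord0 !mxE /= addr0.
Qed.

Lemma vec2E (v : 'cV[int]_2) : v = vec2 (v 0 0) (v 1 0).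
Proof.
apply/matrixP => -[[|[|//]] ?] [[|//] ?]; rewrite mxE /=;
  by congr (v _ _); exact: val_inj.
Qed.

Lemma vec2D a b c d : vec2 a b + vec2 c d = vec2 (a + c) (b + d).
Proof. by rewrite [LHS]vec2E !mxE. Qed.

Lemma vec2Z k a b : k *: vec2 a b = vec2 (k * a) (k * b).
Proof. by rewrite [LHS]vec2E !mxE. Qed.

Lemma mulmx_vec2_inj (g h : 'M[int]_2) :
  (forall x : 'cV[int]_2, g *m x = h *m x) -> g = h.
Proof.
move=> e; have := e (vec2 1 0); have := e (vec2 0 1).
elim/mat2_ind: g {e} => a b c d; elim/mat2_ind: h => a' b' c' d'.
have inj x y x' y' : vec2 x y = vec2 x' y' -> x = x' /\ y = y'.
  by move/matrixP=> h; move: (h 0 0) (h 1 0); rewrite !mxE.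
by rewrite !mat2_vec2 => /inj[e1 e2] /inj[e3 e4]; congr mat2; lia.
Qed.

Definition mat2_ringE := (mat2_1, mat2Z, mat2N, mat2D, mat2M).

(** The theorem of Cayley and Hamilton: traces and determinants alone control
    the powers of a matrix. *)
Lemma mat2_sqr (g : 'M[int]_2) : g * g = \tr g *: g - \det g *: 1.
Proof.
elim/mat2_ind: g => a b c d; rewrite tr_mat2 det_mat2 !mat2_ringE.
by congr mat2; ring.
Qed.

(** This is the value at [1] of the characteristic polynomial. *)
Lemma det_sub1 (g : 'M[int]_2) : \det (g - 1) = 1 - \tr g + \det g.
Proof.
elim/mat2_ind: g => a b c d; rewrite tr_mat2 !mat2_ringE !det_mat2; ring.
Qed.

Lemma tr_mat2_sqr (g : 'M[int]_2) : \tr (g * g) = \tr g ^+ 2 - \det g *+ 2.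
Proof.
elim/mat2_ind: g => a b c d; rewrite !mat2_ringE !tr_mat2 !det_mat2; ring.
Qed.

Lemma mat2_detN (g : 'M[int]_2) : \det (- g) = \det g.
Proof. by elim/mat2_ind: g => a b c d; rewrite mat2N !det_mat2; ring. Qed.

Lemma det_unit_mat2 (g : 'M[int]_2) :
  g \is a GRing.unit -> \det g = 1 \/ \det g = -1.
Proof.
rewrite -[_ \is a _]/(g \in unitmx) unitmxE.
by case/orP => /eqP; [left|right].
Qed.

Lemma det_exprz (g : 'M[int]_2) (n : int) :
  g \is a GRing.unit -> \det (g ^ n) = \det g ^ n.
Proof.
move=> gU; symmetry; apply: (exprz_unique (f := fun n => \det (g ^ n))).
- by rewrite -unitmxE.
- by rewrite expr0z det1.
by move=> {}n; rewrite exprzDr // expr1z -mulmxE det_mulmx.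
Qed.

Lemma neg1_mat2 : -1 != 1 :> 'M[int]_2.
Proof. by rewrite mat2_1 mat2N; apply/eqP => /mat2_inj[]. Qed.

Lemma mx_congr_mat2 (k : nat) a b c d a' b' c' d' :
  (k %| a - a')%Z -> (k %| b - b')%Z -> (k %| c - c')%Z -> (k %| d - d')%Z ->
  mx_congr k (mat2 a b c d) (mat2 a' b' c' d').
Proof.
move=> /dvdzP[x ha] /dvdzP[y hb] /dvdzP[z hc] /dvdzP[t hd].
exists (mat2 x y z t); rewrite mat2Z mat2D.
by rewrite ![k%:Z * _]mulrC -ha -hb -hc -hd ![_ + (_ - _)]addrC !subrK.
Qed.

(** * Torsion among the matrices of each type *)

(** The nilpotent part [g - 1] has square zero, so the binomial expansion stops
    after the linear term. *)
Lemma unipotent_exprz (g : 'M[int]_2) (n : int) :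
  \det g = 1 -> \tr g = 2 -> g ^ n = 1 + n *: (g - 1).
Proof.
move=> dg tg; apply: (exprz_unique (f := fun n => 1 + n *: (g - 1))).
- by rewrite -[_ \is a _]/(g \in unitmx) unitmxE dg.
- by rewrite scale0r addr0.
move=> {}n; move: dg tg; elim/mat2_ind: g => a b c d.
rewrite det_mat2 tr_mat2 !mat2_ringE => dg tg.
have -> : d = 2 - a by lia.
have bc : b * c = 2 * a - a ^+ 2 - 1 by lia.
have nbc : n * (b * c) = n * (2 * a - a ^+ 2 - 1) by rewrite bc.
by congr mat2; lia.
Qed.

Lemma unipotent_torsion_free (g : 'M[int]_2) (n : int) :
  \det g = 1 -> \tr g = 2 -> n != 0 -> g ^ n = 1 -> g = 1.
Proof.
move=> dg tg n0; rewrite unipotent_exprz // => e.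
have /eqP : n *: (g - 1) = 0 by apply: (addrI 1); rewrite addr0.
by rewrite scalemx_eq0 (negbTE n0) subr_eq0 => /eqP.
Qed.

(** The traces [t_k] of the powers satisfy [t_(k+2) = t t_(k+1) - t_k] with [t
    >= 3], so they increase strictly from [t_0 = 2], which is the trace of the
    identity. *)
Lemma hyperbolic_torsion_free (g : 'M[int]_2) (n : int) :
  \det g = 1 -> 3 <= \tr g -> g ^ n = 1 -> n = 0.
Proof.
move=> dg tg.
have step k : \tr (g ^+ k.+2) = \tr g * \tr (g ^+ k.+1) - \tr (g ^+ k).
  rewrite exprSr exprSr -mulrA mat2_sqr dg scale1r mulrBr mulr1 -scalerAr.
  by rewrite raddfB /= mxtraceZ -exprSr.
have base : 2 <= (2%:R : int) < \tr g by rewrite lexx (lt_le_trans _ tg).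
have grow k : 2 <= \tr (g ^+ k) < \tr (g ^+ k.+1).
  elim: k => [|k]; first by rewrite expr0 expr1 mxtrace1.
  rewrite step; move: (\tr g) (\tr (g ^+ k)) (\tr (g ^+ k.+1)) tg => t x y.
  by nia.
have pos k : g ^+ k.+1 <> 1.
  move=> e; have /andP[le2] := grow k; rewrite e mxtrace1 => /(le_lt_trans le2).
  by rewrite ltxx.
case: n => [[|k]|k] //; first by move/pos.
rewrite NegzE -invr_expz => e; case: (pos k); apply: invr_inj.
by rewrite invr1 -e.
Qed.

Lemma order3_cube (g : 'M[int]_2) : \det g = 1 -> \tr g = -1 -> g ^ 3 = 1.
Proof.
move=> d t; rewrite -[_ ^ 3]/(g * (g * g)) mat2_sqr d t scaleN1r scale1r.
by rewrite mulrBr mulrN mat2_sqr d t scaleN1r scale1r mulr1 opprB opprK addrK.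
Qed.

Lemma reflection_sqr (g : 'M[int]_2) : \det g = -1 -> \tr g = 0 -> g ^ 2 = 1.
Proof.
move=> d t; rewrite -[_ ^ 2]/(g * g) mat2_sqr d t.
by rewrite scale0r scaleN1r sub0r opprK.
Qed.

Lemma order3_dvd (g : 'M[int]_2) n :
  g \is a GRing.unit -> \det g = 1 -> \tr g = -1 -> g ^ n = 1 -> (3 %| n)%Z.
Proof.
move=> gU d t; apply: (@exprz_prime_dvd _ _ 3) => //; last exact: order3_cube.
by apply: contra_eq_neq t => ->; rewrite mxtrace1.
Qed.

Lemma reflection_dvd (g : 'M[int]_2) n :
  g \is a GRing.unit -> \det g = -1 -> \tr g = 0 -> g ^ n = 1 -> (2 %| n)%Z.
Proof.
move=> gU d t; apply: (@exprz_prime_dvd _ _ 2) => //; last exact: reflection_sqr.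
by apply: contra_eq_neq t => ->; rewrite mxtrace1.
Qed.

Lemma neg1_dvd n : (-1 : 'M[int]_2) ^ n = 1 -> (2 %| n)%Z.
Proof.
apply: (@exprz_prime_dvd _ _ 2); rewrite ?unitrN1 ?neg1_mat2 //.
by rewrite -[_ ^ _]/((-1) ^+ 2) sqrrN expr1n.
Qed.

Lemma neg1_mat2_cube : (-1 : 'M[int]_2) ^ 3 <> 1.
Proof. by move/neg1_dvd. Qed.

(** In dimension two [-1] has determinant [1], so the determinant detects the
    parity of the exponent of the reflection. *)
Lemma reflection_neg1_dvd (g : 'M[int]_2) x y :
  g \is a GRing.unit -> \det g = -1 -> \tr g = 0 ->
  g ^ x * (-1) ^ y = 1 -> (2 %| x)%Z /\ (2 %| y)%Z.
Proof.
move=> gU d t e; have := congr1 determinant e.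
rewrite -mulmxE det_mulmx !det_exprz ?unitrN1 // mat2_detN d det1 exp1rz mulr1.
move=> /(@exprz_prime_dvd _ (-1) 2 _)x2.
have {x2} x2 : (2 %| x)%Z by apply: x2.
split=> //; apply: neg1_dvd; move: e; case/dvdzP: x2 => k ->.
by rewrite (mulrC k) -exprz_exp reflection_sqr // exp1rz mul1r.
Qed.

(** The exponent [n] is the one provided by [lambda_exponent] when both its
    elements are [g]. Except for unipotent matrices and reflections it is
    nonzero, so [g] has finite order. A trace too large for that already
    contradicts [hyperbolic_torsion_free], applied to [g] or, when the trace is
    negative or the determinant is [-1], to its square. *)
Lemma mat2_types (g : 'M[int]_2) (n := 1 - \tr g + \det g) :
  g \is a GRing.unit -> g ^ n = 1 ->
  [\/ \det g = 1 /\ \tr g = 2,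
      \det g = 1 /\ \tr g = -1,
      g = -1
    | \det g = -1 /\ \tr g = 0].
Proof.
move=> gU gn; have g2n : (g * g) ^ n = 1.
  by rewrite -expr2 exprnP exprz_exp mulrC -exprz_exp gn exp1rz.
have hyp1 d1 t3 := hyperbolic_torsion_free d1 t3 gn.
have := @hyperbolic_torsion_free (g * g) n; rewrite tr_mat2_sqr -mulmxE det_mulmx.
rewrite mulmxE => hyp2; have {hyp2} hyp2 d1 t3 := hyp2 d1 t3 g2n.
have CH := mat2_sqr g; have [t et] : exists t : int, \tr g = t by exists (\tr g).
rewrite et in CH hyp1 hyp2 *; move: (erefl n); rewrite {2}/n et => en.
move: (n) gn {g2n} hyp1 hyp2 en => {n} n gn hyp1 hyp2 en.
case: (det_unit_mat2 gU) => d1; rewrite d1 in CH hyp1 hyp2 en *; last first.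
  constructor 4; split=> //; case: (eqVneq t 0) => // t0.
  by have := hyp2 erefl; nia.
have {hyp1} t2 : t <= 2 by have := hyp1 erefl; lia.
have {hyp2} tN2 : -2 <= t by have := hyp2 erefl; nia.
have [t0|[t0|[t0|[t0|t0]]]] : t = 2 \/ t = 1 \/ t = 0 \/ t = -1 \/ t = -2 by lia.
- by constructor 1.
- have n1 : n = 1 by lia.
  by move: gn et; rewrite n1 expr1z => ->; rewrite mxtrace1; lia.
- have n1 : n = 2 by lia.
  move: gn; rewrite n1 -[g ^ 2]/(g * g) CH t0 scale0r scale1r sub0r.
  by move=> e; have := neg1_mat2; rewrite e eqxx.
- by constructor 2.
- constructor 3; apply: oppr_inj; rewrite opprK.
  have n1 : n = 4 by lia.
  apply: (@unipotent_torsion_free _ 4) => //.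
  + by rewrite mat2_detN.
  + by rewrite raddfN /= et; lia.
  by rewrite -[_ ^ 4]/((- g) ^+ (2 * 2)) exprM sqrrN -exprM -gn n1.
Qed.

(** * Lambda-homomorphic braces as families of commuting matrices *)

(** What remains of a lambda-homomorphic brace structure on the additive group
    of column vectors once [sb_lambda] is written in matrix form. The last field
    is the compatibility with the multiplication of the brace. *)
Record lambda_data (L : 'cV[int]_2 -> 'M[int]_2) : Prop := LambdaData {
  lambda0 : L 0 = 1;
  lambdaD : forall a b, L (a + b) = L a * L b;
  lambda_invariant : forall a b, L (L a *m b) = L b
}.

Lemma additive_intscale (f : 'cV[int]_2 -> 'cV[int]_2) :
  (forall x y, f (x + y) = f x + f y) -> forall n x, f (n *: x) = n *: f x.
Proof.
move=> fD n x; have f0 : f 0 = 0 by apply: (addrI (f 0)); rewrite -fD !addr0.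
have fS m : f ((m + 1) *: x) = f (m *: x) + f x.
  by rewrite scalerDl fD scale1r.
elim/int_rect: n => [|n IHn|n IHn]; first by rewrite !scale0r.
- have -> : n.+1%:Z = n%:Z + 1 by lia.
  by rewrite fS IHn scalerDl scale1r.
- apply: (addIr (f x)); rewrite -fS -[X in _ = _ + X]scale1r -scalerDl.
  by have -> : - n.+1%:Z + 1 = - n%:Z by lia.
Qed.

(** The two zero elements of a skew brace agree, and associativity of the
    product reads [L (a + L a b) = L a * L b]. The right side is also [L (a +
    b)], and cancelling [L a] gives the invariance of [L]. *)
Lemma brace_lambda_data (B : skew_brace 'cV[int]_2) :
  lambda_homomorphic B -> (forall x y, sb_add B x y = x + y) ->
  exists L, lambda_data L /\ forall a x, sb_mul B a x = a + L a *m x.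
Proof.
move=> hom add.
have zero : sb_zero B = 0.
  by have := is_group_idl (sb_add_group B) 0; rewrite add addr0.
have opp x : sb_opp B x = - x.
  apply: (addrI x); rewrite addrN.
  by have := is_group_invr (sb_add_group B) x; rewrite add zero.
have lamE a x : sb_lambda B a x = sb_mul B a x - a.
  by rewrite /sb_lambda add opp addrC.
have distr a x y : sb_mul B a (x + y) = sb_mul B a x - a + sb_mul B a y.
  by rewrite -add sb_distr !add opp.
have lamD a x y : sb_lambda B a (x + y) = sb_lambda B a x + sb_lambda B a y.
  by rewrite !lamE distr addrA.
have bmul0 a : sb_mul B a 0 = a.
  have := distr a 0 0; rewrite addr0 -addrA -{1}[sb_mul B a 0]addr0.
  by move/addrI/esym/eqP; rewrite addrC subr_eq0 => /eqP.
have one : sb_one B = 0.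
  by rewrite -[LHS]bmul0 (is_group_idl (sb_mul_group B)).
pose L a := mat2 (sb_lambda B a (vec2 1 0) 0 0) (sb_lambda B a (vec2 0 1) 0 0)
                 (sb_lambda B a (vec2 1 0) 1 0) (sb_lambda B a (vec2 0 1) 1 0).
have LE a x : L a *m x = sb_lambda B a x.
  rewrite [x]vec2E; move: (x 0 0) (x 1 0) => {x} x y.
  have -> : vec2 x y = x *: vec2 1 0 + y *: vec2 0 1.
    by rewrite !vec2Z vec2D !mulr1 !mulr0 addr0 add0r.
  rewrite lamD !(additive_intscale (lamD a)).
  rewrite [sb_lambda B a (vec2 1 0)]vec2E [sb_lambda B a (vec2 0 1)]vec2E.
  rewrite !vec2Z !vec2D mulr1 mulr0 addr0 mulr1 mulr0 add0r mat2_vec2.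
  by congr vec2; rewrite ?mxE /=; ring.
have mulE a x : sb_mul B a x = a + L a *m x by rewrite LE lamE addrC subrK.
have L0 : L 0 = 1.
  apply: mulmx_vec2_inj => x; rewrite LE lamE -one.
  by rewrite (is_group_idl (sb_mul_group B)) one subr0 mul1mx.
have LD a b : L (a + b) = L a * L b.
  by apply: mulmx_vec2_inj => x; rewrite LE -add hom /= -!LE mulmxA.
have LM a b : L (a + L a *m b) = L a * L b.
  apply: mulmx_vec2_inj => x; apply: (addrI (a + L a *m b)).
  have ab : a + L a *m b = sb_mul B a b by rewrite mulE.
  rewrite !ab -[LHS]mulE -(is_group_assoc (sb_mul_group B)) !mulE.
  by rewrite mulmxDr addrA -mulmxE mulmxA.
exists L; split; last exact: mulE.
apply: (LambdaData L0 LD) => a b.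
have LaK : L (- a) * L a = 1 by rewrite -LD addNr.
by rewrite -[LHS]mul1r -[RHS]mul1r -LaK -!mulrA -[L a * L b]LM LD.
Qed.

Lemma lambda_unit L a : lambda_data L -> L a \is a GRing.unit.
Proof.
by case=> L0 LD _; apply/unitrP; exists (L (- a)); rewrite -!LD addrN addNr L0.
Qed.

Lemma lambda_comm L a b : lambda_data L -> L a * L b = L b * L a.
Proof. by case=> _ LD _; rewrite -!LD addrC. Qed.

Lemma lambdaZ L n a : lambda_data L -> L (n *: a) = L a ^ n.
Proof.
move=> hL; case: (hL) => L0 LD _; symmetry.
apply: (exprz_unique (f := fun n => L (n *: a))); first exact: lambda_unit.
  by rewrite scale0r.
by move=> {}n; rewrite scalerDl scale1r LD.
Qed.

Lemma lambdaV L a : lambda_data L -> L (- a) = (L a)^-1.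
Proof. by move=> hL; rewrite -scaleN1r lambdaZ. Qed.

Lemma lambda_comb L u v x y : lambda_data L ->
  L (x *: u + y *: v) = L u ^ x * L v ^ y.
Proof. by move=> hL; rewrite (lambdaD hL) !lambdaZ. Qed.

Lemma lambda_vec2 L x y : lambda_data L ->
  L (vec2 x y) = L (vec2 1 0) ^ x * L (vec2 0 1) ^ y.
Proof.
move=> hL; rewrite -!lambdaZ // -(lambdaD hL) !vec2Z vec2D.
by rewrite !mulr0 !mulr1 addr0 add0r.
Qed.

Lemma lambda_ker L a b : lambda_data L -> L (L a *m b - b) = 1.
Proof.
move=> hL; case: (hL) => L0 LD LI.
by rewrite LD LI -LD addrN L0.
Qed.

(** Since [g * \adj g = \det g], all multiples of [\det (L a - 1)] lie in the
    image of [L a - 1], which is contained in the kernel of [L]. *)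
Lemma lambda_exponent L a b : lambda_data L ->
  L b ^ (1 - \tr (L a) + \det (L a)) = 1.
Proof.
move=> hL; rewrite -det_sub1 -lambdaZ //.
have -> : \det (L a - 1) *: b = (L a - 1) *m (\adj (L a - 1) *m b).
  by rewrite mulmxA mul_mx_adj mul_scalar_mx.
by rewrite mulmxBl mul1mx lambda_ker.
Qed.

(** The kernel relations for the columns of [L v - 1], which generate the image
    of [L v - 1]: the source of the congruences, and of the equations for
    unipotent pairs. *)
Lemma lambda_columns L v a b c d : lambda_data L -> L v = mat2 a b c d ->
  L (vec2 (a - 1) c) = 1 /\ L (vec2 b (d - 1)) = 1.
Proof.
move=> hL e; have h w := lambda_ker v w hL.
split; [have := h (vec2 1 0)|have := h (vec2 0 1)]; rewrite e mat2_vec2;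
  rewrite -scaleN1r vec2Z vec2D => <-; congr (L (vec2 _ _)); ring.
Qed.

Lemma lambda_types L v : lambda_data L ->
  [\/ \det (L v) = 1 /\ \tr (L v) = 2,
      \det (L v) = 1 /\ \tr (L v) = -1,
      L v = -1
    | \det (L v) = -1 /\ \tr (L v) = 0].
Proof.
move=> hL; apply: mat2_types (lambda_exponent v v hL); exact: lambda_unit.
Qed.

Lemma lambda_cube_eq1 L v : lambda_data L -> L v ^ 3 = 1 ->
  L v = 1 \/ \det (L v) = 1 /\ \tr (L v) = -1.
Proof.
move=> hL g3; have gU := lambda_unit v hL.
have := congr1 determinant g3; rewrite det_exprz // det1 => d3.
case: (lambda_types v hL) => [[d t]|[d t]|e|[d t]].
- by left; apply: (unipotent_torsion_free d t _ g3).
- by right.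
- case/eqP: neg1_mat2; rewrite -[RHS]g3 e.
  by rewrite -[_ ^ 3]/((-1) ^+ 3) exprS sqrrN expr1n mulr1.
- by move: d3; rewrite d.
Qed.

Lemma lambda_pow4_eq1 L v : lambda_data L -> L v ^ 4 = 1 ->
  [\/ L v = 1, L v = -1 | \det (L v) = -1 /\ \tr (L v) = 0].
Proof.
move=> hL g4; have gU := lambda_unit v hL.
case: (lambda_types v hL) => [[d t]|[d t]|e|[d t]].
- by constructor 1; apply: (unipotent_torsion_free d t _ g4).
- by constructor 1; rewrite -(exprz_gcd_eq1 gU (order3_cube d t) g4) expr1z.
- by constructor 2.
- by constructor 3.
Qed.

(** * Two unipotent matrices *)

(** The point [(u0 : u1 : u2 : u3)] of the twisted cubic with [u0] nonzero is
    determined by the ratio [u0 : u1], which is [p : q] in lowest terms. As [p ^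
    3] divides [q ^ 3 u0] it divides [u0], and the quotient is [m]. *)
Lemma twisted_cubic (u0 u1 u2 u3 : int) :
  u1 ^+ 2 = u0 * u2 -> u2 ^+ 2 = u1 * u3 -> u0 * u3 = u1 * u2 ->
  exists p q m : int, gcdz p q = 1 /\
    [/\ u0 = m * p ^+ 3, u1 = m * p ^+ 2 * q,
        u2 = m * p * q ^+ 2 & u3 = m * q ^+ 3].
Proof.
case: (eqVneq u0 0) => [->|u0n].
  rewrite !mul0r => /eqP; rewrite sqrf_eq0 => /eqP ->; rewrite mul0r.
  move=> /eqP; rewrite sqrf_eq0 => /eqP -> _.
  by exists 0, 1, u3; split=> //; split; ring.
move=> e1 e2 e3.
have gn : gcdz u0 u1 != 0 by rewrite gcdz_eq0 negb_and u0n.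
have [/dvdzP[p ep] /dvdzP[q eq]] := (dvdz_gcdl u0 u1, dvdz_gcdr u0 u1).
move: (gcdz u0 u1) (Bezoutz u0 u1) gn ep eq => g [x [y bez]] gn ep eq.
have cpq : coprimez p q.
  apply/coprimezP; exists (x, y) => /=; apply: (mulIf gn).
  by rewrite mul1r -[RHS]bez ep eq; ring.
have pn : p != 0 by apply: contra u0n => /eqP p0; rewrite ep p0 mul0r.
have s1 : p * u1 = q * u0 by rewrite ep eq; ring.
have s2 : p * u2 = q * u1.
  apply: (mulIf gn); have : u0 * u2 = u1 * u1 by rewrite -e1.
  by rewrite {1}ep {1}eq => h; rewrite mulrAC h; ring.
have s3 : p * u3 = q * u2.
  apply: (mulIf gn); move: e3.
  by rewrite {1}ep {1}eq => h; rewrite mulrAC h; ring.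
have : (p ^+ 3 %| q ^+ 3 * u0)%Z.
  apply/dvdzP; exists u3.
  have -> : u3 * p ^+ 3 = p ^+ 2 * (p * u3) by ring.
  rewrite s3; have -> : p ^+ 2 * (q * u2) = p * q * (p * u2) by ring.
  rewrite s2; have -> : p * q * (q * u1) = q ^+ 2 * (p * u1) by ring.
  by rewrite s1; ring.
rewrite Gauss_dvdzr; last by apply: coprimezXl; apply: coprimezXr.
case/dvdzP => m em; have cancel := mulfI pn.
have f1 : u1 = m * p ^+ 2 * q by apply: cancel; rewrite s1 em; ring.
have f2 : u2 = m * p * q ^+ 2 by apply: cancel; rewrite s2 f1; ring.
have f3 : u3 = m * q ^+ 3 by apply: cancel; rewrite s3 f2; ring.
by exists p, q, m; split; [apply/eqP|].
Qed.

(** Commutation makes the product the scalar matrix with entry [s = a a' + b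
    c'], and nilpotency makes the square of [s] vanish: in coordinates, [(a a')
    ^ 2 = (b c') ^ 2 = - (a a') (b c')]. *)
Lemma commuting_nilpotents_mul (a b c a' b' c' : int) :
  a ^+ 2 + b * c = 0 -> a' ^+ 2 + b' * c' = 0 ->
  mat2 a b c (- a) * mat2 a' b' c' (- a') =
    mat2 a' b' c' (- a') * mat2 a b c (- a) ->
  mat2 a b c (- a) * mat2 a' b' c' (- a') = 0.
Proof.
rewrite !mat2M => dM dN /mat2_inj[e1 e2 e3 _].
have {e1} e1 : b * c' = b' * c by lia.
have {e2} e2 : a' * b = a * b' by lia.
have {e3} e3 : a * c' = a' * c by lia.
have h1 : (a * a') ^+ 2 = (b * c') ^+ 2.
  have -> : (b * c') ^+ 2 = (b * c') * (b' * c) by rewrite -e1.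
  have -> : b * c' * (b' * c) = (b * c) * (b' * c') by ring.
  have -> : b * c = - a ^+ 2 by lia.
  have -> : b' * c' = - a' ^+ 2 by lia.
  by ring.
have h2 : a * a' * (b * c') = - (a * a') ^+ 2.
  have -> : a * a' * (b * c') = a * c' * (a' * b) by ring.
  rewrite e2; have -> : a * c' * (a * b') = a ^+ 2 * (b' * c') by ring.
  have -> : b' * c' = - a' ^+ 2 by lia.
  by ring.
have /eqP : (a * a' + b * c') ^+ 2 = 0.
  have -> : (a * a' + b * c') ^+ 2 =
    (a * a') ^+ 2 + (b * c') ^+ 2 + 2 * (a * a' * (b * c')) by ring.
  by rewrite -h1 h2; ring.
rewrite sqrf_eq0 => /eqP s0.
have -> : 0 = mat2 0 0 0 0 by rewrite [LHS]mat2E !mxE.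
by congr mat2; lia.
Qed.

Lemma unipotent_mat2 (g : 'M[int]_2) : \det g = 1 -> \tr g = 2 ->
  exists a b c, g - 1 = mat2 a b c (- a) /\ a ^+ 2 + b * c = 0.
Proof.
elim/mat2_ind: g => a b c d; rewrite det_mat2 tr_mat2 !mat2_ringE => dg tg.
exists (a - 1), b, c; have -> : d = 2 - a by lia.
by split; [congr mat2|]; nia.
Qed.

Lemma unipotent_pair L :
  lambda_data L ->
  let phi := L (vec2 1 0) in let psi := L (vec2 0 1) in
  \det phi = 1 -> \tr phi = 2 -> \det psi = 1 -> \tr psi = 2 ->
  exists p q m : int,
    [/\ gcdz p q = 1,
        phi = mat2 (1 + m * p ^+ 2 * q) (m * p * q ^+ 2)
                   (- (m * p ^+ 3)) (1 - m * p ^+ 2 * q)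
      & psi = mat2 (1 + m * p * q ^+ 2) (m * q ^+ 3)
                   (- (m * p ^+ 2 * q)) (1 - m * p * q ^+ 2)].
Proof.
move=> hL phi psi d1 t1 d2 t2.
have comm : (phi - 1) * (psi - 1) = (psi - 1) * (phi - 1).
  apply: commrB; last exact: commr1.
  apply/commr_sym/commrB; last exact: commr1.
  exact: lambda_comm.
have [a [b [c [eM dM]]]] := unipotent_mat2 d1 t1.
have [a' [b' [c' [eN dN]]]] := unipotent_mat2 d2 t2.
have MN : (phi - 1) * (psi - 1) = 0.
  by move: comm; rewrite eM eN; apply: commuting_nilpotents_mul.
(* Without a quadratic term, relations between exponents become linear. *)
have lin x y : L (vec2 x y) = 1 -> x *: (phi - 1) + y *: (psi - 1) = 0.
  rewrite lambda_vec2 // -/phi -/psi !unipotent_exprz // => e.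
  apply: (addrI 1); rewrite addr0 -[RHS]e mulrDl mul1r mulrDr mulr1.
  by rewrite -scalerAr -scalerAl MN !scaler0 addr0 addrAC addrA.
have ephi : phi = mat2 (1 + a) b c (1 - a).
  by rewrite -[phi](subrK 1) eM !mat2_ringE; congr mat2; ring.
have epsi : psi = mat2 (1 + a') b' c' (1 - a').
  by rewrite -[psi](subrK 1) eN !mat2_ringE; congr mat2; ring.
have [/lin l1 /lin l2] := lambda_columns hL ephi.
have [/lin l3 /lin l4] := lambda_columns hL epsi.
have z2 : 0 = mat2 0 0 0 0 by rewrite [LHS]mat2E !mxE.
move: l1 l2 l3 l4; rewrite eM eN z2 !mat2_ringE.
move=> /mat2_inj[r1 r2 r3 _] /mat2_inj[r4 r5 r6 _].
move=> /mat2_inj[r7 r8 r9 _] /mat2_inj[r10 r11 r12 _].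
have ba' : a' = b.
  case: (eqVneq a 0) => [a0|an]; last by apply: (mulfI an); lia.
  have /eqP : b ^+ 2 = 0 by rewrite a0 in r5; lia.
  rewrite sqrf_eq0 => /eqP b0.
  have /eqP : a' ^+ 2 = 0 by rewrite a0 in r10; lia.
  by rewrite sqrf_eq0 b0 => /eqP.
subst b.
have c'a : c' = - a.
  case: (eqVneq c 0) => [c0|cn]; last by apply: (mulfI cn); lia.
  have /eqP : a ^+ 2 = 0 by rewrite c0 in dM; lia.
  rewrite sqrf_eq0 => /eqP a0.
  have /eqP : c' ^+ 2 = 0 by rewrite c0 in r9; lia.
  by rewrite sqrf_eq0 a0 oppr0 => /eqP.
subst c'.
have [p [q [m [g1 [e0 e1 e2 e3]]]]] : exists p q m : int, gcdz p q = 1 /\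
    [/\ - c = m * p ^+ 3, a = m * p ^+ 2 * q,
        a' = m * p * q ^+ 2 & b' = m * q ^+ 3].
  by apply: twisted_cubic; lia.
exists p, q, m; split=> //.
- by rewrite ephi -e1 -e2 -e0 opprK.
- by rewrite epsi -e1 -e2 -e3.
Qed.

(** * Pairs with an element of finite order *)

(** The product of the two is a reflection as well; the squares of both
    reflections are trivial, hence so is the square of the unipotent matrix. *)
Lemma unipotent_with_reflection L u v : lambda_data L ->
  \det (L u) = 1 -> \tr (L u) = 2 -> \det (L v) = -1 -> \tr (L v) = 0 ->
  L u = 1.
Proof.
move=> hL d1 t1 d2 t2; apply: (unipotent_torsion_free (n := 2)) => //.
have duv : \det (L (u + v)) = -1.
  by rewrite (lambdaD hL) -mulmxE det_mulmx d1 d2.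
have tuv : \tr (L (u + v)) = 0.
  by case: (lambda_types (u + v) hL) => [[d _]|[d _]|e|[] //];
    move: duv; rewrite ?d ?e ?mat2_detN ?det1.
rewrite -(reflection_sqr duv tuv) -[RHS]lambdaZ // scalerDr lambda_comb //.
by rewrite (reflection_sqr d2 t2) mulr1.
Qed.

(** The traces of [phi psi] and [phi psi^-1] add up to [\tr phi * \tr psi = 1],
    whereas elements of order three have trace [-1]; so one of these two
    products is the identity. *)
Lemma order3_pair L (hL : lambda_data L)
    (phi := L (vec2 1 0)) (psi := L (vec2 0 1)) :
  \det phi = 1 -> \tr phi = -1 -> \det psi = 1 -> \tr psi = -1 ->
  psi = phi \/ psi = phi^-1.
Proof.
move=> d1 t1 d2 t2.
have pU : psi \is a GRing.unit by apply: lambda_unit.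
have cube v : L v ^ 3 = 1.
  by have := lambda_exponent (vec2 1 0) v hL; rewrite -/phi d1 t1.
(* This is psi ^ 2 + psi + 1 = 0 multiplied by psi^-1. *)
have psiV : psi^-1 = -1 - psi.
  apply: (mulrI pU); rewrite mulrV // mulrBr mulrN1 mat2_sqr d2 t2.
  by rewrite scaleN1r scale1r opprB opprK addrCA addNr addr0.
have LD : L (vec2 1 0 + vec2 0 1) = phi * psi by rewrite (lambdaD hL).
have LB : L (vec2 1 0 - vec2 0 1) = phi * psi^-1.
  by rewrite (lambdaD hL) lambdaV.
case: (lambda_cube_eq1 hL (cube (vec2 1 0 + vec2 0 1))); rewrite LD.
  move=> e; right; rewrite -[LHS](mulKr (x := phi)) ?e ?mulr1 //.
  exact: lambda_unit.
case: (lambda_cube_eq1 hL (cube (vec2 1 0 - vec2 0 1))); rewrite LB.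
  by move=> e _; left; rewrite -[RHS](mulrVK pU) e mul1r.
rewrite psiV mulrBr mulrN1 raddfB raddfN /= t1 => -[_ tB] [_ tD].
by rewrite tD in tB.
Qed.

(** The product of two commuting reflections has determinant [1] and order
    dividing two, which leaves [1] and [-1]. *)
Lemma reflection_pair L (hL : lambda_data L)
    (phi := L (vec2 1 0)) (psi := L (vec2 0 1)) :
  \det phi = -1 -> \tr phi = 0 -> \det psi = -1 -> \tr psi = 0 ->
  psi = phi \/ psi = - phi.
Proof.
move=> d1 t1 d2 t2.
have LD : L (vec2 1 0 + vec2 0 1) = phi * psi by rewrite (lambdaD hL).
have pp : phi * phi = 1 by rewrite -(reflection_sqr d1 t1).
have g4 : L (vec2 1 0 + vec2 0 1) ^ 4 = 1.
  have := @lambda_comb L (vec2 1 0) (vec2 0 1) 4 4 hL; rewrite -/phi -/psi.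
  rewrite -scalerDr lambdaZ // => ->.
  rewrite -[4]/(2 * 2 : int) -!exprz_exp (reflection_sqr d1 t1) (reflection_sqr d2 t2).
  by rewrite exp1rz mulr1.
have key : psi = phi * L (vec2 1 0 + vec2 0 1) by rewrite LD mulrA pp mul1r.
case: (lambda_pow4_eq1 hL g4) => [e|e|[]].
- by left; rewrite key e mulr1.
- by right; rewrite key e mulrN1.
- by rewrite LD -mulmxE det_mulmx d1 d2.
Qed.

(** * Congruences from the kernel *)

Lemma congr3_of_phi_eq1 L (hL : lambda_data L)
    (phi := L (vec2 1 0)) (psi := L (vec2 0 1)) :
  phi = 1 -> \det psi = 1 -> \tr psi = -1 ->
  exists x : int, mx_congr 3 psi (mat2 1 x 0 1).
Proof.
move=> p1 d t; have pU : psi \is a GRing.unit by apply: lambda_unit.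
have K x y : L (vec2 x y) = 1 -> (3 %| y)%Z.
  by rewrite lambda_vec2 // -/phi p1 exp1rz mul1r; apply: order3_dvd.
have := lambda_columns (v := vec2 0 1) hL; rewrite -/psi.
elim/mat2_ind: (psi) t {d pU} => a b c d; rewrite tr_mat2 => t.
move=> /(_ _ _ _ _ erefl)[/K k1 /K k2].
by exists b; apply: mx_congr_mat2; lia.
Qed.

Lemma congr3_of_psi_eq1 L (hL : lambda_data L)
    (phi := L (vec2 1 0)) (psi := L (vec2 0 1)) :
  psi = 1 -> \det phi = 1 -> \tr phi = -1 ->
  exists x : int, mx_congr 3 phi (mat2 1 0 x 1).
Proof.
move=> p1 d t; have pU : phi \is a GRing.unit by apply: lambda_unit.
have K x y : L (vec2 x y) = 1 -> (3 %| x)%Z.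
  by rewrite lambda_vec2 // -/psi p1 exp1rz mulr1; apply: order3_dvd.
have := lambda_columns (v := vec2 1 0) hL; rewrite -/phi.
elim/mat2_ind: (phi) t {d pU} => a b c d; rewrite tr_mat2 => t.
move=> /(_ _ _ _ _ erefl)[/K k1 /K k2].
by exists c; apply: mx_congr_mat2; lia.
Qed.

Lemma congr2_of_phi_eq1 L (hL : lambda_data L)
    (phi := L (vec2 1 0)) (psi := L (vec2 0 1)) :
  phi = 1 -> \det psi = -1 -> \tr psi = 0 ->
  exists x : int, mx_congr 2 psi (mat2 1 x 0 1).
Proof.
move=> p1 d t; have pU : psi \is a GRing.unit by apply: lambda_unit.
have K x y : L (vec2 x y) = 1 -> (2 %| y)%Z.
  by rewrite lambda_vec2 // -/phi p1 exp1rz mul1r; apply: reflection_dvd.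
have := lambda_columns (v := vec2 0 1) hL; rewrite -/psi.
elim/mat2_ind: (psi) t {d pU} => a b c d; rewrite tr_mat2 => t.
move=> /(_ _ _ _ _ erefl)[/K k1 /K k2].
by exists b; apply: mx_congr_mat2; lia.
Qed.

Lemma congr2_of_psi_eq1 L (hL : lambda_data L)
    (phi := L (vec2 1 0)) (psi := L (vec2 0 1)) :
  psi = 1 -> \det phi = -1 -> \tr phi = 0 ->
  exists x : int, mx_congr 2 phi (mat2 1 0 x 1).
Proof.
move=> p1 d t; have pU : phi \is a GRing.unit by apply: lambda_unit.
have K x y : L (vec2 x y) = 1 -> (2 %| x)%Z.
  by rewrite lambda_vec2 // -/psi p1 exp1rz mulr1; apply: reflection_dvd.
have := lambda_columns (v := vec2 1 0) hL; rewrite -/phi.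
elim/mat2_ind: (phi) t {d pU} => a b c d; rewrite tr_mat2 => t.
move=> /(_ _ _ _ _ erefl)[/K k1 /K k2].
by exists c; apply: mx_congr_mat2; lia.
Qed.

(** The kernel consists of the [(x, y)] with [x + y] divisible by three.
    Together with the trace this determines [phi] modulo three from its first
    entry, whose three residues give the three cases. *)
Lemma congr3_of_psi_eq_phi L (hL : lambda_data L)
    (phi := L (vec2 1 0)) (psi := L (vec2 0 1)) :
  psi = phi -> \det phi = 1 -> \tr phi = -1 ->
  [\/ mx_congr 3 phi (mat2 0 2 1 2), mx_congr 3 phi (mat2 2 1 2 0)
    | mx_congr 3 phi 1%:M].
Proof.
move=> e d t; have pU : phi \is a GRing.unit by apply: lambda_unit.
have K x y : L (vec2 x y) = 1 -> (3 %| x + y)%Z.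
  by rewrite lambda_vec2 // -/psi e -exprzDr //; apply: order3_dvd.
have := lambda_columns (v := vec2 1 0) hL; rewrite -/phi.
elim/mat2_ind: (phi) t {d e pU} => a b c d; rewrite tr_mat2 => t.
move=> /(_ _ _ _ _ erefl)[/K k1 /K k2].
rewrite -[1%:M]/(1 : 'M[int]_2) mat2_1.
have [a0|[a2|a1]] : (3 %| a)%Z \/ (3 %| a - 2)%Z \/ (3 %| a - 1)%Z by lia.
- by constructor 1; apply: mx_congr_mat2; lia.
- by constructor 2; apply: mx_congr_mat2; lia.
- by constructor 3; apply: mx_congr_mat2; lia.
Qed.

Lemma congr3_of_psi_eq_inv L (hL : lambda_data L)
    (phi := L (vec2 1 0)) (psi := L (vec2 0 1)) :
  psi = phi^-1 -> \det phi = 1 -> \tr phi = -1 ->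
  [\/ mx_congr 3 phi (mat2 0 1 2 2), mx_congr 3 phi (mat2 2 2 1 0)
    | mx_congr 3 phi 1%:M].
Proof.
move=> e d t; have pU : phi \is a GRing.unit by apply: lambda_unit.
have K x y : L (vec2 x y) = 1 -> (3 %| x - y)%Z.
  by rewrite lambda_vec2 // -/psi e exprz_inv -exprzDr //; apply: order3_dvd.
have := lambda_columns (v := vec2 1 0) hL; rewrite -/phi.
elim/mat2_ind: (phi) t {d e pU} => a b c d; rewrite tr_mat2 => t.
move=> /(_ _ _ _ _ erefl)[/K k1 /K k2].
rewrite -[1%:M]/(1 : 'M[int]_2) mat2_1.
have [a0|[a2|a1]] : (3 %| a)%Z \/ (3 %| a - 2)%Z \/ (3 %| a - 1)%Z by lia.
- by constructor 1; apply: mx_congr_mat2; lia.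
- by constructor 2; apply: mx_congr_mat2; lia.
- by constructor 3; apply: mx_congr_mat2; lia.
Qed.

Lemma congr2_of_psi_eq_phi L (hL : lambda_data L)
    (phi := L (vec2 1 0)) (psi := L (vec2 0 1)) :
  psi = phi -> \det phi = -1 -> \tr phi = 0 ->
  mx_congr 2 phi 1%:M \/ mx_congr 2 phi (mat2 0 1 1 0).
Proof.
move=> e d t; have pU : phi \is a GRing.unit by apply: lambda_unit.
have K x y : L (vec2 x y) = 1 -> (2 %| x + y)%Z.
  by rewrite lambda_vec2 // -/psi e -exprzDr //; apply: reflection_dvd.
have := lambda_columns (v := vec2 1 0) hL; rewrite -/phi.
elim/mat2_ind: (phi) t {d e pU} => a b c d; rewrite tr_mat2 => t.
move=> /(_ _ _ _ _ erefl)[/K k1 /K k2].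
rewrite -[1%:M]/(1 : 'M[int]_2) mat2_1.
have [a0|a1] : (2 %| a)%Z \/ (2 %| a - 1)%Z by lia.
- by right; apply: mx_congr_mat2; lia.
- by left; apply: mx_congr_mat2; lia.
Qed.

Lemma congr2_of_even_kernel L v : lambda_data L ->
  (forall x y, L (vec2 x y) = 1 -> (2 %| x)%Z /\ (2 %| y)%Z) ->
  mx_congr 2 (L v) 1%:M.
Proof.
move=> hL K; have := @lambda_columns L v; move: (L v).
elim/mat2_ind => a b c d /(_ _ _ _ _ hL erefl)[/K[k1 k2] /K[k3 k4]].
by rewrite -[1%:M]/(1 : 'M[int]_2) mat2_1; apply: mx_congr_mat2; lia.
Qed.

Lemma congr2_of_phi_eqN1 L v (hL : lambda_data L)
    (phi := L (vec2 1 0)) (psi := L (vec2 0 1)) :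
  phi = -1 -> \det psi = -1 -> \tr psi = 0 -> mx_congr 2 (L v) 1%:M.
Proof.
move=> p1 d t; apply: congr2_of_even_kernel => // x y e.
suff [] : (2 %| y)%Z /\ (2 %| x)%Z by [].
apply: (@reflection_neg1_dvd psi) => //; first exact: lambda_unit.
rewrite -p1 -lambda_comb // -e !vec2Z vec2D; congr (L (vec2 _ _)); ring.
Qed.

Lemma congr2_of_psi_eqN1 L v (hL : lambda_data L)
    (phi := L (vec2 1 0)) (psi := L (vec2 0 1)) :
  psi = -1 -> \det phi = -1 -> \tr phi = 0 -> mx_congr 2 (L v) 1%:M.
Proof.
move=> p1 d t; apply: congr2_of_even_kernel => // x y e.
apply: (@reflection_neg1_dvd phi) => //; first exact: lambda_unit.
by rewrite -p1 -lambda_vec2.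
Qed.

Lemma congr2_of_psi_eqN_phi L v (hL : lambda_data L)
    (phi := L (vec2 1 0)) (psi := L (vec2 0 1)) :
  psi = - phi -> \det phi = -1 -> \tr phi = 0 -> mx_congr 2 (L v) 1%:M.
Proof.
move=> p1 d t; apply: congr2_of_even_kernel => // x y e.
suff : (2 %| x + y)%Z /\ (2 %| y)%Z by lia.
have pU : phi \is a GRing.unit by apply: lambda_unit.
apply: (@reflection_neg1_dvd phi) => //.
(* phi ^ x psi ^ y = phi ^ (x + y) (phi^-1 psi) ^ y, and phi^-1 psi = -1. *)
have <- : L (vec2 (-1) 1) = -1.
  rewrite lambda_vec2 // -/phi -/psi p1 expr1z.
  by rewrite -[phi ^ _]/(phi^-1) mulrN mulVr.
rewrite -lambda_comb // -e !vec2Z vec2D; congr (L (vec2 _ _)); ring.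
Qed.

(** * Classification *)

(** A case distinction on the types of [phi] and [psi]; the pairs that cannot
    occur are excluded by the exponent that one element imposes on the other. *)
Theorem theoremA (B : skew_brace 'cV[int]_2)
    (B_brace : is_brace B)
    (B_lambda : lambda_homomorphic B)
    (B_add : forall x y : 'cV[int]_2, sb_add B x y = x + y) :
  exists phi psi : 'M[int]_2,
    [/\ phi \in unitmx, psi \in unitmx,
      forall a1 a2 b1 b2 : int,
        sb_add B (vec2 a1 a2) (vec2 b1 b2) = vec2 (a1 + b1) (a2 + b2) /\
        sb_mul B (vec2 a1 a2) (vec2 b1 b2) =
          vec2 a1 a2 + phi ^ a1 *m psi ^ a2 *m vec2 b1 b2
    & [\/ [/\ \det phi = 1, \det psi = 1 &
            ((phi = 1%:M \/ phi = - 1%:M) /\ (psi = 1%:M \/ psi = - 1%:M))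
            \/ (exists p q m : int,
                 [/\ gcdz p q = 1,
                     phi = mat2 (1 + m * p ^+ 2 * q) (m * p * q ^+ 2)
                                (- (m * p ^+ 3)) (1 - m * p ^+ 2 * q)
                   & psi = mat2 (1 + m * p * q ^+ 2) (m * q ^+ 3)
                                (- (m * p ^+ 2 * q)) (1 - m * p * q ^+ 2)])
            \/ [/\ phi = 1%:M,
                   exists x : int, mx_congr 3 psi (mat2 1 x 0 1)
                 & \tr psi = -1]
            \/ [/\ exists x : int, mx_congr 3 phi (mat2 1 0 x 1),
                   \tr phi = -1
                 & psi = 1%:M]
            \/ [/\ \tr phi = -1, psi = phi
                 & [\/ mx_congr 3 phi (mat2 0 2 1 2),
                       mx_congr 3 phi (mat2 2 1 2 0)
                     | mx_congr 3 phi 1%:M]]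
            \/ [/\ \tr phi = -1, psi = phi^-1
                 & [\/ mx_congr 3 phi (mat2 0 1 2 2),
                       mx_congr 3 phi (mat2 2 2 1 0)
                     | mx_congr 3 phi 1%:M]]],
          [/\ \det phi = 1, \det psi = -1 &
            [/\ phi = 1%:M,
                exists x : int, mx_congr 2 psi (mat2 1 x 0 1)
              & \tr psi = 0]
            \/ [/\ phi = - 1%:M, mx_congr 2 psi 1%:M & \tr psi = 0]],
          [/\ \det phi = -1, \det psi = 1 &
            [/\ exists x : int, mx_congr 2 phi (mat2 1 0 x 1),
                \tr phi = 0
              & psi = 1%:M]
            \/ [/\ mx_congr 2 phi 1%:M, \tr phi = 0 & psi = - 1%:M]]
        | [/\ \det phi = -1, \det psi = -1 &
            [/\ \tr phi = 0, psi = phi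
              & mx_congr 2 phi 1%:M \/ mx_congr 2 phi (mat2 0 1 1 0)]
            \/ [/\ mx_congr 2 phi 1%:M, \tr phi = 0 & psi = - phi]]]].
Proof.
have [L [hL mulE]] := brace_lambda_data B_lambda B_add.
exists (L (vec2 1 0)), (L (vec2 0 1)); split.
- exact: (lambda_unit (vec2 1 0) hL).
- exact: (lambda_unit (vec2 0 1) hL).
- move=> a1 a2 b1 b2; rewrite B_add vec2D mulE; split=> //.
  by rewrite (lambda_vec2 a1 a2 hL).
have exp v w := lambda_exponent v w hL.
have det1' : \det (1 : 'M[int]_2) = 1 by exact: det1.
have detN1 : \det (-1 : 'M[int]_2) = 1 by rewrite mat2_detN.
case: (lambda_types (vec2 1 0) hL) => [[d1 t1]|[d1 t1]|e1|[d1 t1]];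
case: (lambda_types (vec2 0 1) hL) => [[d2 t2]|[d2 t2]|e2|[d2 t2]].
- constructor 1; split=> //; right; left.
  exact: unipotent_pair.
- have e1 : L (vec2 1 0) = 1.
    have := exp (vec2 0 1) (vec2 1 0); rewrite d2 t2.
    exact: unipotent_torsion_free.
  constructor 1; split=> //; do 2 right; left; split=> //.
  exact: congr3_of_phi_eq1.
- have e1 : L (vec2 1 0) = 1.
    have := exp (vec2 0 1) (vec2 1 0); rewrite e2 detN1 raddfN /= mxtrace1.
    exact: unipotent_torsion_free.
  constructor 1; rewrite e1 e2 in d1 t1 *; split=> //; left.
  by split; [left|right].
- have e1 : L (vec2 1 0) = 1.
    exact: unipotent_with_reflection d2 t2.
  constructor 2; split=> //; left; split=> //.
  exact: congr2_of_phi_eq1.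
- have e2 : L (vec2 0 1) = 1.
    have := exp (vec2 1 0) (vec2 0 1); rewrite d1 t1.
    exact: unipotent_torsion_free.
  constructor 1; split=> //; do 3 right; left; split=> //.
  exact: congr3_of_psi_eq1.
- case: (order3_pair hL d1 t1 d2 t2) => e.
  + constructor 1; split=> //; do 4 right; left; split=> //.
    exact: congr3_of_psi_eq_phi.
  + constructor 1; split=> //; do 5 right; split=> //.
    exact: congr3_of_psi_eq_inv.
- have := exp (vec2 1 0) (vec2 0 1); rewrite d1 t1 e2 => /neg1_mat2_cube.
  by [].
- have := exp (vec2 1 0) (vec2 0 1); rewrite d1 t1 => h.
  by case: (lambda_cube_eq1 hL h) => [e|[d _]]; move: d2; rewrite ?e ?det1' ?d.
- have e2 : L (vec2 0 1) = 1.
    have := exp (vec2 1 0) (vec2 0 1); rewrite e1 detN1 raddfN /= mxtrace1.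
    exact: unipotent_torsion_free.
  constructor 1; rewrite e1 e2 in d2 t2 *; split=> //; left.
  by split; [right|left].
- have := exp (vec2 0 1) (vec2 1 0); rewrite d2 t2 e1 => /neg1_mat2_cube.
  by [].
- constructor 1; rewrite e1 e2; split=> //; left.
  by split; right.
- constructor 2; split=> //; first by rewrite e1.
  right; split=> //; exact: congr2_of_phi_eqN1.
- have e2 : L (vec2 0 1) = 1.
    exact: unipotent_with_reflection d1 t1.
  constructor 3; split=> //; left; split=> //.
  exact: congr2_of_psi_eq1.
- have := exp (vec2 0 1) (vec2 1 0); rewrite d2 t2 => h.
  by case: (lambda_cube_eq1 hL h) => [e|[d _]]; move: d1; rewrite ?e ?det1' ?d.
- constructor 3; split=> //; first by rewrite e2.
  right; split=> //; exact: congr2_of_psi_eqN1.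
- case: (reflection_pair hL d1 t1 d2 t2) => e.
  + constructor 4; split=> //; left; split=> //; exact: congr2_of_psi_eq_phi.
  + constructor 4; split=> //; right; split=> //; exact: congr2_of_psi_eqN_phi.
Qed.
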